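(* Let $V\subset\mathbb{R}^d$ ($d\in\{1,2,3\}$) be a control volume with finite volume mesh $\mathcal{T}_h=\{V_1,\dots,V_N\}$, let $T>0$, let $\Delta t>0$ be the time step, and let $\theta$, $K$, $S$ be the soil moisture content, hydraulic conductivity and sink functions satisfying the standing properties given in the context. For $m\in\{0,1,\dots,\lceil T/\Delta t\rceil-1\}$, let $\psi^m\in Q_h(V)$ be given and let $\{\psi^{m+1,s}\}_{s}\subset Q_h(V)$ be a sequence generated by the adaptive fixed-point iteration: given $\psi^m,\psi^{m+1,s}\in Q_h(V)$, the next iterate $\psi^{m+1,s+1}\in Q_h(V)$ is such that, for every $v\in Q_h(V)$, $$\big\langle\theta(\psi^{m+1,s+1})-\theta(\psi^{m}),v\big\rangle_{V}+\frac{\Delta t}{\tau^{m+1,s}}\big\langle\psi^{m+1,s+1}-\psi^{m+1,s},v\big\rangle_{V}+\Delta t\,\big\langle S(\psi^{m+1,s+1}),v\big\rangle_{V}=-\Delta t\,\big\langle K(\theta(\psi^{m+1}))\,\mathrm{GRAD}_h(\psi^{m+1,s+1}+z),\mathrm{GRAD}_h(v)\big\rangle_{\mathcal{E}_h},$$ where $\psi^{m+1}$ denotes the discrete solution at time step $m+1$. Then, for each $m=0,1,\dots,\lceil T/\Delta t\rceil-1$, the sequence $\{\psi^{m+1,s}\}_s$ converges to a unique solution $\psi^{m+1}\in Q_h(V)$, i.e. to the unique discrete solution $\psi^{m+1}$ of the finite-volume-discretized Richards equation.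
   Context: **Equation.** The Richards equation is $\partial_t\theta(\psi)+\nabla\cdot\mathbf q=-S(\psi)$, $\mathbf q=-K(\theta(\psi))\nabla(\psi+z)$, on $V$ for $t\in[0,T]$, where $\psi$ is the pressure head, $\theta$ the soil moisture content (water retention curve), $K$ the (positive) unsaturated hydraulic conductivity, $S$ the sink term, and $z$ the vertical coordinate. It is discretized in time by implicit Euler with step $\Delta t$; $m$ indexes time steps, $s$ indexes fixed-point iterations, and $\psi^0$ is given by the initial condition $\psi_0$. **Discrete spaces.** $V$ is partitioned into cells $\mathcal{T}_h=\{V_1,\dots,V_N\}$, where $h$ is the maximum cell dimension, and $Q_h=Q_h(V)=\{v\in L^2(V): v|_{V_i}\text{ is constant for all }V_i\in\mathcal{T}_h\}$. For $f,g\in Q_h$ with cell values $f_i,g_i$, $\langle f,g\rangle_{V_i}=\int_{V_i}fg\,dV=f_ig_i\,\mathrm{vol}(V_i)$ and $\langle f,g\rangle_V=\sum_{i=1}^N\langle f,g\rangle_{V_i}$; $\|\cdot\|_{L^2}$ is the associated norm. $\mathcal{E}_h$ is the set of all faces of the mesh. $\mathrm{GRAD}_h$ is the discrete gradient operator, a linear operator mapping a cell-based function in $Q_h$ to a face-based function approximating the gradient (on a face shared by $V_i$ and $V_j$, the difference quotient of the cell values divided by $\mathrm{dist}(V_i,V_j)$), and $\langle\cdot,\cdot\rangle_{\mathcal{E}_h}$ is the discrete $L^2$ inner product of face-based functions (a sum over faces with positive weights). In such expressions $z$ stands for its cell values, and $K(\theta(\psi^{m+1}))$ for its values on faces. **Discrete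 solution.** Given $\psi^m\in Q_h$, a function $\psi^{m+1}\in Q_h$ is a discrete solution of the FVM-discretized Richards equation if for every $v\in Q_h$ $$\langle\theta(\psi^{m+1})-\theta(\psi^m),v\rangle_V+\Delta t\,\langle K(\theta(\psi^{m+1}))\,\mathrm{GRAD}_h(\psi^{m+1}+z),\mathrm{GRAD}_h(v)\rangle_{\mathcal{E}_h}+\Delta t\,\langle S(\psi^{m+1}),v\rangle_V=0.$$ **Linearization parameter.** $\tau^{m+1,s}>0$ is the adaptive linearization parameter, which may change with $m$ and $s$ and is bounded above by a user-specified global constant $\tau_0>0$. **Standing properties.** $\theta$ and $S$ are differentiable functions of $\psi$ with $\dot\theta(\psi)=\frac{d\theta}{d\psi}\ge c_0>0$ for a constant $c_0$, and $\dot S(\psi)=\frac{dS}{d\psi}\ge 0$, on the range of pressure heads considered; $K>0$.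
   Formalization: Adds that the sum over s of τ^{m+1,s} diverges (convergence fails otherwise); uniqueness, false among all discrete solutions, is stated for the limit of the iterates and for the equation with conductivity fixed at K(θ(ψ^{m+1})), for values in the range considered. *)

(* Defs.v *)
From HB Require Import structures.
From mathcomp Require Import all_boot all_order all_algebra.
From mathcomp Require Import all_classical all_reals all_analysis.

Set Implicit Arguments.
Unset Strict Implicit.
Unset Printing Implicit Defensive.

Import Order.TTheory GRing.Theory Num.Theory.
Import numFieldNormedType.Exports.

Local Open Scope classical_set_scope.
Local Open Scope ring_scope.

(* d-dimensional Lebesgue volume, as an iterated integral (Tonelli); the
   library has no Lebesgue measure on d.-tuple R. Meaningful for measurable
   sets, the only ones it is applied to. *)
Fixpoint volume (R : realType) (d : nat) : set (d.-tuple R) -> \bar R :=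
  match d with
  | 0 => fun A => (\1_A [tuple])%:E
  | d'.+1 => fun A =>
      (\int[@lebesgue_measure R]_x
         volume [set t : d'.-tuple R | A [tuple of (x : R) :: t]])%E
  end.

(* An element of Q_h is determined by its N cell values, and is represented by
   them. *)
Notation Qh R N := {ffun 'I_N -> R}.

(* A finite volume mesh of [fv_domain] in R^d with N cells, together with the
   discrete operators living on it.
   - [fv_adj e = Some (i, j)]: e is the face shared by V_i and V_j (in this
     order, which fixes the sign of the difference quotient on e);
     [fv_adj e = None]: e is a boundary face. On boundary faces GRAD_h is only
     required to be linear, so that no boundary condition is singled out.
   - [fv_dist i j] is dist(V_i, V_j); its definition (e.g. between cell centres)
     is left open.
   - [fv_weight] are the weights of the inner product of face functions.
   - [fv_toface] produces face values from cell values (arithmetic mean,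
     harmonic mean, ...); it sends positive data to positive data. *)
Record fv_mesh (R : realType) (d N : nat) := FVMesh {
  fv_domain : set (d.-tuple R);
  fv_cell : 'I_N -> set (d.-tuple R);
  fv_cell_measurable : forall i, measurable (fv_cell i);
  fv_cell_volume : forall i, (0 < volume (fv_cell i) < +oo)%E;
  fv_cell_disjoint : trivIset setT fv_cell;
  fv_cell_cover : \bigcup_i fv_cell i = fv_domain;
  fv_face : finType;
  fv_adj : fv_face -> option ('I_N * 'I_N);
  fv_adj_neq : forall e i j, fv_adj e = Some (i, j) -> i != j;
  fv_dist : 'I_N -> 'I_N -> R;
  fv_dist_gt0 : forall i j, i != j -> 0 < fv_dist i j;
  fv_dist_sym : forall i j, fv_dist i j = fv_dist j i;
  fv_grad : {linear Qh R N -> {ffun fv_face -> R}};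
  fv_grad_interior : forall e i j, fv_adj e = Some (i, j) ->
    forall f : Qh R N, fv_grad f e = (f j - f i) / fv_dist i j;
  fv_weight : fv_face -> R;
  fv_weight_gt0 : forall e, 0 < fv_weight e;
  fv_toface : Qh R N -> {ffun fv_face -> R};
  fv_toface_gt0 : forall f : Qh R N,
    (forall i, 0 < f i) -> forall e, 0 < fv_toface f e
}.

Section Scheme.
Variables (R : realType) (d N : nat) (M : fv_mesh R d N).

Definition cell_vol (i : 'I_N) : R := fine (volume (fv_cell M i)).

Definition dotV (f g : Qh R N) : R := \sum_i f i * g i * cell_vol i.

Definition normL2 (f : Qh R N) : R := Num.sqrt (dotV f f).

Definition dotE (p q : {ffun fv_face M -> R}) : R :=
  \sum_e fv_weight e * (p e * q e).

Definition cellwise (f : R -> R) (u : Qh R N) : Qh R N := [ffun i => f (u i)].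

(* K(theta(u)) on faces, from its cell values. *)
Definition face_cond (theta K : R -> R) (u : Qh R N) : {ffun fv_face M -> R} :=
  fv_toface M (cellwise (K \o theta) u).

Definition flux (kappa : {ffun fv_face M -> R}) (u : Qh R N) :
    {ffun fv_face M -> R} :=
  [ffun e => kappa e * fv_grad M u e].

(* [u] solves one implicit Euler step from [um] in which the face conductivity
   is the prescribed [kappa]. *)
Definition solves_step (theta S : R -> R) (z : Qh R N) (dt : R)
    (kappa : {ffun fv_face M -> R}) (um u : Qh R N) : Prop :=
  forall v : Qh R N,
    dotV (cellwise theta u - cellwise theta um) v
    + dt * dotE (flux kappa (u + z)) (fv_grad M v)
    + dt * dotV (cellwise S u) v = 0.

Definition discrete_solution (theta K S : R -> R) (z : Qh R N) (dt : R)
    (um u : Qh R N) : Prop :=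
  solves_step theta S z dt (face_cond theta K u) um u.

(* [next] is an iterate following [cur], where [usol] is the discrete solution
   entering the conductivity. *)
Definition fixed_point_step (theta K S : R -> R) (z : Qh R N) (dt tau : R)
    (um usol cur next : Qh R N) : Prop :=
  forall v : Qh R N,
    dotV (cellwise theta next - cellwise theta um) v
    + dt / tau * dotV (next - cur) v
    + dt * dotV (cellwise S next) v
    = - dt * dotE (flux (face_cond theta K usol) (next + z)) (fv_grad M v).

Definition cvgL2 (u : nat -> Qh R N) (l : Qh R N) : Prop :=
  normL2 (u s - l) @[s --> \oo] --> (0 : R).

End Scheme.

(* The standing properties of theta, K, S on the range D of pressure heads. *)
Definition standing_properties (R : realType) (D : set R) (c0 : R)
    (theta K S : R -> R) : Prop :=
  [/\ 0 < c0,
      is_interval D,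
      forall x, D x -> derivable theta x 1 /\ c0 <= derive1 theta x,
      forall x, D x -> derivable S x 1 /\ 0 <= derive1 S x
    & forall x, D x -> 0 < K (theta x)].

Definition values_in (R : realType) (N : nat) (D : set R) (u : Qh R N) : Prop :=
  forall i, D (u i).

(* Main.v *)
(* Testing the difference of the equations for two iterates with the new error
   [e'], monotonicity of [theta], [S] and of the discrete diffusion gives
   [c0 |e'|^2 + dt / tau <e' - e, e'> <= 0], hence
   [(1 + 2 c0 tau / dt) |e'|^2 <= |e|^2]. The product of these contraction
   factors dominates [1 + 2 c0 / dt * \sum tau], which diverges. *)
Require Import Defs.
From mathcomp Require Import all_boot all_order all_algebra.
From mathcomp Require Import all_classical all_reals all_analysis.
From mathcomp Require Import ring lra.

Set Implicit Arguments.
Unset Strict Implicit.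
Unset Printing Implicit Defensive.

Import Order.TTheory GRing.Theory Num.Theory.
Import numFieldNormedType.Exports.

Local Open Scope classical_set_scope.
Local Open Scope ring_scope.

(** Mean value theorem on the segment joining the two points, which stays in [D] because [D] is an
    interval. Both sides are symmetric in [x] and [y], so the case [x < y] suffices. *)
Lemma interval_derive_ge_monotone (R : realType) (D : set R) (f : R -> R)
    (c : R) : is_interval D ->
  (forall x, D x -> derivable f x 1 /\ c <= derive1 f x) ->
  forall x y, D x -> D y -> c * (x - y) ^+ 2 <= (f x - f y) * (x - y).
Proof.
move=> itvD df.
have sorted_case x y : D x -> D y -> x < y ->
    c * (x - y) ^+ 2 <= (f x - f y) * (x - y).
  move=> Dx Dy xy.
  have inD w : x <= w <= y -> D w by move=> xwy; exact: (itvD x y).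
  have [||t t_xy fyx] := @MVT R f (derive1 f) x y xy.
  - move=> w; rewrite in_itv/= => /andP[xw wy].
    have [dfw _] : derivable f w 1 /\ c <= derive1 f w.
      by apply/df/inD; rewrite !ltW.
    by apply: DeriveDef => //; rewrite derive1E.
  - apply: derivable_within_continuous => w; rewrite in_itv/= => xwy.
    by have [] := df _ (inD _ xwy).
  have [_ cf] : derivable f t 1 /\ c <= derive1 f t.
    by apply/df/inD; move: t_xy; rewrite in_itv/= => /andP[xt ty]; rewrite !ltW.
  have -> : (f x - f y) * (x - y) = derive1 f t * (x - y) ^+ 2.
    by rewrite -[f x - f y]opprB fyx; ring.
  by rewrite ler_wpM2r// sqr_ge0.
move=> x y Dx Dy; have [xy|yx|->] := ltgtP x y.
- exact: sorted_case.
- have := sorted_case _ _ Dy Dx yx.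
  by rewrite -[x - y]opprB sqrrN -[f x - f y]opprB mulrNN.
- by rewrite !subrr expr0n/= !mulr0.
Qed.

Lemma contraction_cvg0 (R : realType) (a : R) (tau err : R^nat) : 0 < a ->
  (forall s, 0 < tau s) -> (forall s, 0 <= err s) ->
  (forall s, (1 + a * tau s) * err s.+1 <= err s) ->
  series tau @ \oo --> +oo -> err @ \oo --> (0 : R).
Proof.
move=> a0 tau0 err0 contr tau_div.
have sum_ge0 s : 0 <= series tau s.
  by rewrite /series/= sumr_ge0// => i _; rewrite ltW.
have decay s : (1 + a * series tau s) * err s <= err 0%N.
  elim: s => [|s IHs]; first by rewrite /series/= big_geq// mulr0 addr0 mul1r.
  (* [series tau s] sums the terms of index below [s], so the new term is [tau s], the one in the
     factor from [err s] to [err s.+1]. *)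
  rewrite (_ : series tau s.+1 = series tau s + tau s); last first.
    by rewrite /series/= big_nat_recr.
  apply: le_trans IHs.
  apply: (@le_trans _ _
    ((1 + a * series tau s) * ((1 + a * tau s) * err s.+1))).
    (* Cross term of the product of the two factors; dropping it leaves
       [1 + a * (series tau s + tau s)]. *)
    have := mulr_ge0 (mulr_ge0 (mulr_ge0 (ltW a0) (sum_ge0 s))
      (mulr_ge0 (ltW a0) (ltW (tau0 s)))) (err0 s.+1).
    by nra.
  by rewrite ler_wpM2l// addr_ge0// mulr_ge0// ltW.
apply/cvgr0Pnorm_le => eps eps0.
(* Past this threshold [a * series tau s * eps] is at least [err 0]. *)
have := tau_div => /cvgryPge /(_ (err 0%N / (a * eps))).
apply: filterS => s large; rewrite ger0_norm//.
have den_gt0 : 0 < 1 + a * series tau s.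
  by rewrite ltr_pwDl// mulr_ge0// ltW.
rewrite -(ler_pM2l den_gt0) (le_trans (decay s))//.
move: large; rewrite ler_pdivrMr ?mulr_gt0// => large.
by nra.
Qed.

Section Scheme.
Variables (R : realType) (d N : nat) (M : fv_mesh R d N).
Implicit Types f g h u v w : Qh R N.

Lemma cell_vol_gt0 (i : 'I_N) : 0 < cell_vol M i.
Proof. exact/fine_gt0/fv_cell_volume. Qed.

Lemma dotVBl f g h : dotV M (f - g) h = dotV M f h - dotV M g h.
Proof.
rewrite /dotV -sumrB; apply: eq_bigr => i _.
by rewrite !ffunE; ring.
Qed.

Lemma dotV_ge0 f : 0 <= dotV M f f.
Proof.
apply: sumr_ge0 => i _.
by rewrite mulr_ge0 -?expr2 ?sqr_ge0// ltW// cell_vol_gt0.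
Qed.

Lemma dotV_le0 f : dotV M f f <= 0 -> f = 0.
Proof.
move=> f0; apply/ffunP => i; rewrite ffunE.
have term_ge0 j : 0 <= f j * f j * cell_vol M j.
  by rewrite mulr_ge0 -?expr2 ?sqr_ge0// ltW// cell_vol_gt0.
have /eqP : dotV M f f = 0 by apply/le_anti; rewrite f0 dotV_ge0.
rewrite psumr_eq0// => /allP/(_ i (mem_index_enum i))/eqP/eqP.
by rewrite !mulf_eq0 (gt_eqF (cell_vol_gt0 i)) orbF orbb => /eqP.
Qed.

(** Polarization: the gap is half the squared norm of [g - f]. This turns the linearization term
    into a difference of squared errors. *)
Lemma dotV_step_ge f g :
  (dotV M g g - dotV M f f) / 2 <= dotV M (g - f) g.
Proof.
have -> : dotV M (g - f) g =
    (dotV M g g - dotV M f f) / 2 + dotV M (g - f) (g - f) / 2.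
  rewrite /dotV -sumrB !mulr_suml -big_split; apply: eq_bigr => i _ /=.
  by rewrite !ffunE; field.
by rewrite lerDl mulr_ge0 ?dotV_ge0.
Qed.

(** Parallelogram law: the gap is the squared norm of [(u - f) + (u - g)]. It serves as a triangle
    inequality for squared norms. *)
Lemma dotV_dist_le u f g :
  dotV M (f - g) (f - g) <=
    2 * dotV M (u - f) (u - f) + 2 * dotV M (u - g) (u - g).
Proof.
rewrite /dotV !mulr_sumr -big_split; apply: ler_sum => i _ /=.
have := mulr_ge0 (sqr_ge0 ((u - f) i + (u - g) i)) (ltW (cell_vol_gt0 i)).
by rewrite !ffunE; nra.
Qed.

Lemma normL2_sqr f : normL2 M f ^+ 2 = dotV M f f.
Proof. by rewrite sqr_sqrtr ?dotV_ge0. Qed.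

Lemma cvgL2P (s : nat -> Qh R N) f :
  cvgL2 M s f <-> dotV M (s n - f) (s n - f) @[n --> \oo] --> (0 : R).
Proof.
rewrite /cvgL2; split=> cvs.
  under eq_fun do rewrite -normL2_sqr expr2.
  by rewrite -(mulr0 (0 : R)); apply: cvgM.
by rewrite -(sqrtr0 R); apply: continuous_cvg cvs; apply: sqrt_continuous.
Qed.

Lemma cvgL2_unique (s : nat -> Qh R N) f g :
  cvgL2 M s f -> cvgL2 M s g -> f = g.
Proof.
move=> /cvgL2P sf /cvgL2P sg; apply/eqP; rewrite -subr_eq0; apply/eqP.
apply: dotV_le0.
have cv0 : 2 * dotV M (s n - f) (s n - f) + 2 * dotV M (s n - g) (s n - g)
    @[n --> \oo] --> (0 : R).
  rewrite -[0](addr0 (0 : R)) -[0](mulr0 (2 : R)).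
  by apply: cvgD; apply: cvgMl_tmp.
(* The bound [0] becomes the limit of [cv0], whose terms all dominate the constant squared distance
   from [f] to [g]. *)
rewrite -(cvg_lim (@Rhausdorff R) cv0); apply: (limr_ge (cvgP _ cv0)).
by apply: nearW => n; apply: dotV_dist_le.
Qed.

Lemma dotV_monotone (D : set R) (phi : R -> R) (c : R) u w : is_interval D ->
  (forall x, D x -> derivable phi x 1 /\ c <= derive1 phi x) ->
  values_in D u -> values_in D w ->
  c * dotV M (u - w) (u - w) <=
    dotV M (cellwise phi u - cellwise phi w) (u - w).
Proof.
move=> itvD dphi Du Dw; rewrite /dotV mulr_sumr; apply: ler_sum => i _.
rewrite !ffunE mulrA ler_wpM2r ?(ltW (cell_vol_gt0 i))// -expr2.
exact: (interval_derive_ge_monotone itvD dphi (Du i) (Dw i)).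
Qed.

(** Since both fluxes share [kappa] and [fv_grad] is linear, [z] cancels and a positively weighted
    sum of squares of [fv_grad M (u - w)] remains. *)
Lemma dotE_flux_monotone (kappa : {ffun fv_face M -> R}) z u w :
  (forall e, 0 < kappa e) ->
  0 <= dotE (flux kappa (u + z)) (fv_grad M (u - w))
       - dotE (flux kappa (w + z)) (fv_grad M (u - w)).
Proof.
move=> kappa0; rewrite /dotE -sumrB; apply: sumr_ge0 => e _.
have := mulr_ge0 (ltW (mulr_gt0 (fv_weight_gt0 e) (kappa0 e)))
  (sqr_ge0 (fv_grad M (u - w) e)).
by rewrite !ffunE raddfB !raddfD !ffunE; nra.
Qed.

Lemma face_cond_gt0 (D : set R) (theta K : R -> R) u :
  (forall x, D x -> 0 < K (theta x)) -> values_in D u ->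
  forall e, 0 < face_cond M theta K u e.
Proof. by move=> K0 Du; apply: fv_toface_gt0 => i; rewrite ffunE K0. Qed.

Section Step.
Variables (D : set R) (c0 dt : R) (theta K S : R -> R) (z um : Qh R N).
Hypotheses (hprop : standing_properties D c0 theta K S) (dt0 : 0 < dt).

(** The right-hand side is the residual of [u]; subtracting the vanishing residual of [w] leaves
    three monotone differences. As [u] need not solve the step, this serves both uniqueness and the
    iteration. *)
Lemma step_coercive (kappa : {ffun fv_face M -> R}) u w :
  (forall e, 0 < kappa e) -> values_in D u -> values_in D w ->
  solves_step theta S z dt kappa um w ->
  c0 * dotV M (u - w) (u - w) <=
    dotV M (cellwise theta u - cellwise theta um) (u - w)
    + dt * dotE (flux kappa (u + z)) (fv_grad M (u - w))
    + dt * dotV M (cellwise S u) (u - w).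
Proof.
case: hprop => _ itvD dtheta dS _ kappa0 Du Dw /(_ (u - w)).
have := @dotV_monotone D theta c0 u w itvD dtheta Du Dw.
have := mulr_ge0 (ltW dt0) (@dotE_flux_monotone kappa z u w kappa0).
have : 0 <= dt * dotV M (cellwise S u - cellwise S w) (u - w).
  rewrite (mulr_ge0 (ltW dt0))//.
  by have := @dotV_monotone D S 0 u w itvD dS Du Dw; rewrite mul0r.
by rewrite !dotVBl; lra.
Qed.

Lemma solves_step_unique (kappa : {ffun fv_face M -> R}) u w :
  (forall e, 0 < kappa e) -> values_in D u -> values_in D w ->
  solves_step theta S z dt kappa um u -> solves_step theta S z dt kappa um w ->
  u = w.
Proof.
move=> kappa0 Du Dw su sw; apply/eqP; rewrite -subr_eq0; apply/eqP.
apply: dotV_le0; have := step_coercive kappa0 Du Dw sw; rewrite su.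
by rewrite pmulr_rle0//; case: hprop.
Qed.

Lemma fixed_point_step_contract tau usol cur next : 0 < tau ->
  values_in D usol -> values_in D next ->
  discrete_solution M theta K S z dt um usol ->
  fixed_point_step M theta K S z dt tau um usol cur next ->
  (1 + 2 * c0 / dt * tau) * dotV M (next - usol) (next - usol) <=
    dotV M (cur - usol) (cur - usol).
Proof.
move=> tau0 Dsol Dnext sol /(_ (next - usol)) step.
have kappa0 : forall e, 0 < face_cond M theta K usol e.
  by apply: face_cond_gt0 Dsol; case: hprop.
have := step_coercive kappa0 Dnext Dsol sol.
have := dotV_step_ge (cur - usol) (next - usol).
have -> : next - usol - (cur - usol) = next - cur by rewrite opprB addrA subrK.
set E' := dotV M (next - usol) (next - usol).
set E := dotV M (cur - usol) (cur - usol).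
move: step; set X := dotV M (next - cur) _ => step leX coer.
(* By the iteration equation, the residual of [next] is [- (dt / tau) * X]. *)
have {step coer} : c0 * E' + dt / tau * X <= 0 by lra.
have : dt / tau * ((E' - E) / 2) <= dt / tau * X.
  by rewrite ler_wpM2l// ltW// divr_gt0.
move=> le1 le2.
have {le1 le2} : c0 * E' + dt / tau * ((E' - E) / 2) <= 0 by lra.
(* Multiplying by [2 * tau / dt] normalizes the coefficient of [E] to [-1]. *)
rewrite -(pmulr_rle0 _ (divr_gt0 (mulr_gt0 (ltr0n R 2) tau0) dt0)).
have -> : 2 * tau / dt * (c0 * E' + dt / tau * ((E' - E) / 2)) =
    (1 + 2 * c0 / dt * tau) * E' - E.
  by field; rewrite !gt_eqF.
by rewrite subr_le0.
Qed.

End Step.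

End Scheme.

Unset Implicit Arguments.
Set Strict Implicit.

Theorem theorem4p1 (R : realType) (d N : nat) (hd : (1 <= d <= 3)%N)
    (M : fv_mesh R d N) (z : Qh R N)
    (T dt : R) (hT : 0 < T) (hdt : 0 < dt)
    (D : set R) (c0 : R) (theta K S : R -> R)
    (hprop : standing_properties D c0 theta K S)
    (tau0 : R) (htau0 : 0 < tau0) (tau : nat -> nat -> R)
    (psi : nat -> Qh R N)
    (it : nat -> nat -> Qh R N)
    (m : nat) (hm : m%:Z < Num.ceil (T / dt))
    (htau : forall s : nat, 0 < tau m.+1 s <= tau0)
    (htau_div : series (tau m.+1) @ \oo --> +oo)
    (hpsi_range : values_in D (psi m.+1))
    (hpsi : discrete_solution M theta K S z dt (psi m) (psi m.+1))
    (hit_range : forall s : nat, values_in D (it m.+1 s))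
    (hit : forall s : nat,
       fixed_point_step M theta K S z dt (tau m.+1 s) (psi m) (psi m.+1)
         (it m.+1 s) (it m.+1 s.+1)) :
  unique (fun u : Qh R N =>
            [/\ values_in D u,
                discrete_solution M theta K S z dt (psi m) u
              & cvgL2 M (it m.+1) u])
         (psi m.+1)
  /\
  unique (fun u : Qh R N =>
            values_in D u /\
            solves_step theta S z dt (face_cond M theta K (psi m.+1)) (psi m) u)
         (psi m.+1).
Proof.
have [c00 _ _ _ K0] := hprop.
have kappa0 := face_cond_gt0 (M := M) K0 hpsi_range.
have cvg_it : cvgL2 M (it m.+1) (psi m.+1).
  apply/cvgL2P.
  apply: (@contraction_cvg0 R (2 * c0 / dt) (tau m.+1)) => //.
  + by rewrite divr_gt0// mulr_gt0.
  + by move=> s; case/andP: (htau s).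
  + by move=> s; apply: dotV_ge0.
  + move=> s; have /andP[tau_gt0 _] := htau s.
    exact: (fixed_point_step_contract hprop hdt tau_gt0 _ _ hpsi (hit s)).
split; split=> //.
(* Another discrete solution carries its own conductivity, so [step_coercive] does not compare it
   with [psi m.+1]; uniqueness of the limit does. *)
- by move=> u [_ _]; apply: cvgL2_unique.
(* Here the conductivity is frozen at [psi m.+1], so both functions solve the same monotone
   problem. *)
- move=> u [Du su].
  exact: (solves_step_unique hprop hdt kappa0 hpsi_range Du hpsi su).
Qed.
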